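(* Let $n\ge3$ and let $P$ be a positive-area local optimum. There are an integer $s\le n-\dim K_{\mathrm{sh}}(P)$ and points $q_1,\dots,q_s$ in the relative interior of the KKT polytope $\mathcal K(P)$ such that $$K_{\mathrm{sh}}(P)=\bigcap_{\alpha=1}^s\ker B(q_\alpha).$$
   Context: A configuration is $P=(p_1,\dots,p_n)$ with $p_i=(x_i,y_i)\in[0,1]^2$. For a triple $t=(i,j,k)$, $i<j<k$, put $D_t(P)=\det(p_j-p_i,p_k-p_i)$, $A_t(P)=\tfrac12|D_t(P)|$, and $\delta(P)=\min_tA_t(P)$. A positive-area local optimum is a local maximizer $P$ of $\delta$ on $([0,1]^2)^n$ with $\Delta:=\delta(P)>0$. Put $s_t=\operatorname{sgn}D_t(P)$; near $P$, $A_t=\tfrac12s_tD_t$, which is used for derivatives. A normalized KKT multiplier at $P$ is a tuple $q=(\lambda,\ell,r,d,u)$ of nonnegative reals $\lambda_t$ (all triples $t$), $\ell_i,r_i,d_i,u_i$ ($i\in[n]$) with: $\lambda_t=0$ unless $A_t(P)=\Delta$; $\ell_i=0$ unless $x_i=0$, $r_i=0$ unless $x_i=1$, $d_i=0$ unless $y_i=0$, $u_i=0$ unless $y_i=1$; $\sum_t\lambda_t=1$; and $\sum_t\lambda_t\nabla_{p_i}A_t(P)+(\ell_i-r_i,d_i-u_i)=0$ for all $i$. The set of these is the KKT polytope $\mathcal K(P)$. For $t=(i,j,k)$, $i<j<k$, let $B_t=s_t(a_tc_t^T-c_ta_t^T)\in\mathbb R^{n\times n}$ with $a_t=e_j-e_i$,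 $c_t=e_k-e_i$. For $q\in\mathcal K(P)$ let $B(q)=\sum_t\lambda_tB_t$. The shared kernel is $K_{\mathrm{sh}}(P)=\bigcap_{q\in\mathcal K(P)}\ker B(q)\subset\mathbb R^n$. *)

(* Defs.v *)
From HB Require Import structures.
From mathcomp Require Import all_boot all_order all_algebra.
From mathcomp Require Import all_classical all_reals all_analysis.

Set Implicit Arguments.
Unset Strict Implicit.
Unset Printing Implicit Defensive.

Import Order.TTheory GRing.Theory Num.Theory.
Import numFieldNormedType.Exports.

Local Open Scope classical_set_scope.
Local Open Scope ring_scope.

Definition affine_hull (R : realType) (V : normedModType R) (C : set V) : set V :=
  [set x | exists m (a : 'I_m -> R) (y : 'I_m -> V),
     [/\ forall i, C (y i), \sum_i a i = 1 & x = \sum_i a i *: y i]].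

Definition relint (R : realType) (V : normedModType R) (C : set V) : set V :=
  [set x | C x /\ \forall y \near x, affine_hull C y -> C y].

(* Intersection of an arbitrary, possibly infinite, family of subspaces. *)
Lemma vcap_exists (K : fieldType) (V : vectType K) (I : Type) (D : set I)
    (W : I -> {vspace V}) :
  exists U : {vspace V}, forall v, v \in U <-> forall i, D i -> v \in W i.
Proof.
pose p k := `[< exists2 U : {vspace V}, \dim U = k & forall i, D i -> (U <= W i)%VS >].
have p0 : exists k, p k.
  by exists 0%N; apply/asboolP; exists 0%VS; [exact: dimv0 | move=> i _; exact: sub0v].
have pmax k : p k -> (k <= dim V)%N.
  by move=> /asboolP[U <- _]; rewrite -dimvf; apply: dimvS; exact: subvf.
case: (ex_maxnP p0 pmax) => k /asboolP[U dU HU] kmax.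
exists U => w; split=> [wU i Di|Hw]; first exact: subvP (HU _ Di) _ wU.
have /kmax : p (\dim (U + <[w]>)).
  apply/asboolP; exists (U + <[w]>)%VS => // i Di.
  by rewrite subv_add HU //= -memvE; exact: Hw.
rewrite -dU => le_dim.
have /eqP -> : (U == U + <[w]>)%VS by rewrite eqEdim addvSl.
by apply: (subvP (addvSr _ _)); exact: memv_line.
Qed.

Definition vcap (K : fieldType) (V : vectType K) (I : Type) (D : set I)
    (W : I -> {vspace V}) : {vspace V} := projT1 (cid (vcap_exists D W)).

Lemma mem_vcap (K : fieldType) (V : vectType K) (I : Type) (D : set I)
    (W : I -> {vspace V}) (v : V) :
  v \in vcap D W <-> forall i, D i -> v \in W i.
Proof. exact: (projT2 (cid (vcap_exists D W)) v). Qed.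

(* For a nonempty list s, the neutral element head 0 s is itself an entry of s,
   so this is the minimum of s. *)
Definition min_seq (R : realType) (s : seq R) : R :=
  \big[Num.min/head 0 s]_(a <- s) a.

Lemma min_seq_le (R : realType) (s : seq R) (x : R) : x \in s -> min_seq s <= x.
Proof.
rewrite /min_seq; move: (head 0 s) => h.
elim: s => // a s IHs; rewrite inE big_cons ge_min.
by case/predU1P=> [->|/IHs ->]; rewrite ?lexx ?orbT.
Qed.

Lemma min_seq_mem (R : realType) (s : seq R) (x : R) : x \in s -> min_seq s \in s.
Proof.
move=> xs; rewrite /min_seq.
have hs : head 0 s \in s by case: s xs => // a s _; exact: mem_head.
rewrite big_seq; elim/big_ind: _ => // y z ys zs.
by rewrite /Order.min; case: ifP.
Qed.

Section Config.
Variables (R : realType) (n : nat).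

(* The i-th row of P is the point p_i = (x_i, y_i) = (P i 0, P i 1). *)
Definition in_square (P : 'M[R]_(n, 2)) : Prop := forall i c, 0 <= P i c <= 1.

Definition triple : predArgType :=
  {t : 'I_n * 'I_n * 'I_n | (t.1.1 < t.1.2 < t.2)%N}.

Definition fst3 (t : triple) : 'I_n := (val t).1.1.
Definition snd3 (t : triple) : 'I_n := (val t).1.2.
Definition thd3 (t : triple) : 'I_n := (val t).2.

Implicit Types (P : 'M[R]_(n, 2)) (t : triple).

Definition Dt P t : R :=
  \det (col_mx (row (snd3 t) P - row (fst3 t) P)
               (row (thd3 t) P - row (fst3 t) P) : 'M[R]_2).

Definition area P t : R := 2^-1 * `|Dt P t|.

Definition delta P : R := min_seq [seq area P t | t : triple].

Lemma delta_le P t : delta P <= area P t.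
Proof. by apply: min_seq_le; apply/fintype.imageP; exists t. Qed.

Lemma delta_attained P : (3 <= n)%N -> exists t, delta P = area P t.
Proof.
move=> n3.
have H i : (i < 3 -> i < n)%N by move=> /leq_trans; exact.
pose t0 : triple :=
  Sub (Ordinal (H 0%N isT), Ordinal (H 1%N isT), Ordinal (H 2%N isT)) isT.
suff /fintype.imageP[t _ ->] : delta P \in [seq area P t | t : triple] by exists t.
apply: (@min_seq_mem _ _ (area P t0)).
by apply/fintype.imageP; exists t0.
Qed.

Definition positive_area_local_optimum P : Prop :=
  [/\ in_square P,
      \forall Q \near P, in_square Q -> delta Q <= delta P
    & 0 < delta P].

Definition sgnt P t : R := Num.sg (Dt P t).

Definition vec2 (x y : R) : 'rV[R]_2 := \row_(c < 2) [:: x; y]`_c.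

(* Gradient at P, with respect to the i-th point, of Q |-> s_t D_t(Q) / 2,
   where the sign s_t = sgn D_t(P) is frozen at P. *)
Definition grad_area P t (i : 'I_n) : 'rV[R]_2 :=
  \row_(c < 2)
    'D_(delta_mx i c) (fun Q : 'M[R]_(n, 2) => 2^-1 * (sgnt P t * Dt Q t)) P.

(* q = (lambda, l, r, d, u), as an element of a finite-dimensional normed
   space; the coordinates of lambda are indexed by the enumeration of the
   triples. *)
Definition multiplier : normedModType R :=
  ('rV[R]_#|triple| * 'rV[R]_n * 'rV[R]_n * 'rV[R]_n * 'rV[R]_n)%type.

Definition mlam (q : multiplier) t : R := q.1.1.1.1 0 (enum_rank t).
Definition mleft (q : multiplier) (i : 'I_n) : R := q.1.1.1.2 0 i.
Definition mright (q : multiplier) (i : 'I_n) : R := q.1.1.2 0 i.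
Definition mdown (q : multiplier) (i : 'I_n) : R := q.1.2 0 i.
Definition mup (q : multiplier) (i : 'I_n) : R := q.2 0 i.

Definition mult_nonneg (q : multiplier) : Prop :=
  (forall t, 0 <= mlam q t) /\
  (forall i, [/\ 0 <= mleft q i, 0 <= mright q i, 0 <= mdown q i & 0 <= mup q i]).

Definition mult_complementary P (q : multiplier) : Prop :=
  (forall t, area P t <> delta P -> mlam q t = 0) /\
  (forall i, [/\ P i 0 <> 0 -> mleft q i = 0,
                 P i 0 <> 1 -> mright q i = 0,
                 P i 1 <> 0 -> mdown q i = 0
               & P i 1 <> 1 -> mup q i = 0]).

Definition mult_stationary P (q : multiplier) : Prop :=
  forall i, \sum_t mlam q t *: grad_area P t i
            + vec2 (mleft q i - mright q i) (mdown q i - mup q i) = 0.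

Definition KKT P : set multiplier :=
  [set q | [/\ mult_nonneg q, mult_complementary P q,
               \sum_t mlam q t = 1 & mult_stationary P q]].

Definition basis_vec (i : 'I_n) : 'cV[R]_n := delta_mx i 0.

Definition Bt P t : 'M[R]_n :=
  let a := basis_vec (snd3 t) - basis_vec (fst3 t) in
  let c := basis_vec (thd3 t) - basis_vec (fst3 t) in
  sgnt P t *: (a *m c^T - c *m a^T).

Definition Bq P (q : multiplier) : 'M[R]_n := \sum_t mlam q t *: Bt P t.

Definition kerB P (q : multiplier) : {vspace 'cV[R]_n} :=
  lker (linfun (mulmx (Bq P q))).

Lemma mem_kerB P (q : multiplier) (v : 'cV[R]_n) :
  v \in kerB P q <-> Bq P q *m v = 0.
Proof. by rewrite /kerB memv_ker lfunE; split=> /eqP. Qed.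

Definition shared_kernel P : {vspace 'cV[R]_n} := vcap (KKT P) (kerB P).

Lemma mem_shared_kernel P (v : 'cV[R]_n) :
  v \in shared_kernel P <-> forall q, KKT P q -> Bq P q *m v = 0.
Proof.
rewrite mem_vcap; split=> Hv q Kq; first exact/mem_kerB/Hv.
exact/mem_kerB/Hv.
Qed.

End Config.

(* Main.v *)
(** Let q0 be an average of points of KKT P, one for each sign constraint that
    some point satisfies strictly.  Then q0, and the midpoint of q0 with any
    q in KKT P, satisfy strictly every sign constraint that is not identically
    tight on KKT P, hence lie in the relative interior.  Since B is affine, if
    B q v <> 0 then B does not kill v at both q0 and the midpoint of q0 and q.
    So relative interior points cut out the shared kernel, and a greedy choice
    among them lowers the dimension at each step.  If KKT P is empty, no point
    is chosen and the shared kernel is the whole space. *)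
Require Import Defs.
From HB Require Import structures.
From mathcomp Require Import all_boot all_order all_algebra.
From mathcomp Require Import all_classical all_reals all_analysis.
Import Order.TTheory GRing.Theory Num.Theory.
Import numFieldNormedType.Exports.
Local Open Scope classical_set_scope.
Local Open Scope ring_scope.

(** * Greedy selection of finitely many subspaces from a family *)

Lemma vcap_greedy (K : fieldType) (V : vectType K) (I : Type) (D E : set I)
    (W : I -> {vspace V}) :
  E `<=` D ->
  (forall i v, D i -> v \notin W i -> exists2 j, E j & v \notin W j) ->
  exists (s : nat) (q : 'I_s -> I),
    [/\ (s <= dim V - \dim (vcap D W))%N, forall k, E (q k)
      & vcap D W = (\bigcap_(k < s) W (q k))%VS].
Proof.
move=> sED sepE; set C := vcap D W.
have CW i : D i -> (C <= W i)%VS.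
  by move=> Di; apply/subvP => v /mem_vcap; exact.
(* Generalised for induction: [U] is the intersection reached so far and [d] bounds its excess
   dimension over [C], hence the number of choices left. The start is the full space, with [d] the
   codimension of [C]. *)
suff /(_ _ fullv (subvf C) (leqnn _)) [s [szs Es Cs]] : forall d U,
    (C <= U)%VS -> (\dim U - \dim C <= d)%N ->
    exists s : seq I,
      [/\ (size s <= d)%N, forall k : 'I_(size s), E (tnth (in_tuple s) k)
      & C = (U :&: \bigcap_(i <- s) W i)%VS].
  exists (size s), (tnth (in_tuple s)); split => //.
    by rewrite -dimvf.
  by rewrite {1}Cs capfv (big_tnth _ _ s).
have stop d : exists s : seq I,
    [/\ (size s <= d)%N, forall k : 'I_(size s), E (tnth (in_tuple s) k)
      & C = (C :&: \bigcap_(i <- s) W i)%VS].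
  by exists [::]; split => //; [case | rewrite big_nil capvf].
elim=> [|d IHd] U CU leUd.
  by have /eqP <- : C == U by rewrite eqEdim CU -subn_eq0 -leqn0.
have [UC|] := boolP (U <= C)%VS.
  by have /eqP <- : C == U by rewrite eqEsubv CU.
case/subvPn=> v vU vC.
have [i Di vWi] : exists2 i, D i & v \notin W i.
  apply: contrapT => H; case/negP: vC; apply/mem_vcap => i Di.
  by apply: contrapT => /negP vWi; apply: H; exists i.
have {i Di vWi} [j Ej vWj] := sepE i v Di vWi.
have CUW : (C <= U :&: W j)%VS by rewrite subv_cap CU CW//; exact: sED.
(* [v] lies in [U] but not in [W j], so each choice uses up at least one dimension. *)
have ltUW : (\dim (U :&: W j) < \dim U)%N.
  rewrite ltn_neqAle dimvS ?capvSl// andbT.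
  apply: contraNneq vWj => eqd.
  have /eqP UW : (U :&: W j == U)%VS by rewrite eqEdim capvSl eqd leqnn.
  by move: vU; rewrite -UW memv_cap => /andP[].
have [|s [szs Es Cs]] := IHd _ CUW.
  by rewrite -ltnS; apply: leq_trans leUd; rewrite ltn_sub2r//
    (leq_ltn_trans _ ltUW)// dimvS.
exists (j :: s); split => //.
  move=> k; rewrite (tnth_nth j) /=.
  case: k => -[|k] //= ltks; have := Es (Ordinal (ltks : (k < size s)%N)).
  by rewrite (tnth_nth j).
by rewrite big_cons capvA.
Qed.

(** * Relative interior of a set cut out by affine equations and finitely many sign constraints *)

Section Relint.
Variables (R : realType) (V : normedModType R) (I : finType).
Variables (f : I -> {scalar V}) (A : set V).
Hypothesis f_cont : forall i, continuous (f i).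
Hypothesis affA : affine_hull A `<=` A.

Let C : set V := [set x | A x /\ forall i, 0 <= f i x].

(** By continuity, the finitely many constraints positive at [x] stay positive on a common
    neighbourhood. Any other constraint vanishes on all of [C], hence on its affine hull. *)
Lemma relint_strict (x : V) :
  C x -> (forall i y, C y -> 0 < f i y -> 0 < f i x) -> relint C x.
Proof.
move=> Cx posx; split=> //.
have near_pos : \forall y \near x, forall i, 0 < f i x -> 0 < f i y.
  apply: filter_forall => i.
  have [fx|fx] := boolP (0 < f i x); last by apply: filterE.
  exact: filterS (fun y fy _ => fy) (f_cont i x _ (lt_nbhsr fx)).
apply: filterS near_pos => y posy [m [a [z [Cz a1 yE]]]]; split.
  by apply: affA; exists m, a, z; split => // k; have [] := Cz k.
(* If [f i x] is not positive, then [f i] is zero at each [z k], and so at their affine combination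
   [y]. *)
move=> i; have [/posy/ltW//|fix0] := boolP (0 < f i x).
rewrite yE linear_sum big1// => k _; rewrite linearZ/=.
have [_ /(_ i)] := Cz k; rewrite le_eqVlt => /predU1P[<-|]; first by rewrite mulr0.
by move=> /(posx _ _ (Cz k)); rewrite (negPf fix0).
Qed.

Lemma conv_combination m (a : 'I_m -> R) (y : 'I_m -> V) :
  (forall k, 0 <= a k) -> \sum_k a k = 1 -> (forall k, C (y k)) ->
  C (\sum_k a k *: y k).
Proof.
move=> a0 a1 Cy; split.
  by apply: affA; exists m, a, y; split => // k; have [] := Cy k.
move=> i; rewrite linear_sum sumr_ge0// => k _; rewrite linearZ/= mulr_ge0//.
by have [_] := Cy k.
Qed.

Lemma midpoint_combination (x y : V) : C x -> C y -> C (2^-1 *: (x + y)).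
Proof.
move=> Cx Cy.
have -> : 2^-1 *: (x + y) = \sum_(k < 2) 2^-1 *: [:: x; y]`_k.
  by rewrite !big_ord_recl big_ord0 addr0 scalerDr.
apply: conv_combination => [k||[[|[|]]]//].
  by rewrite invr_ge0.
by rewrite !big_ord_recl big_ord0 addr0 [RHS]splitr mul1r.
Qed.

Lemma relint_midpoint : C !=set0 ->
  exists2 x, relint C x & forall y, C y -> relint C (2^-1 *: (x + y)).
Proof.
case=> z Cz.
(* [w i] makes constraint [i] strict if some point of [C] does; otherwise [z] is a default and the
   implication is vacuous. *)
have /choice[w wP] i : exists w, C w /\ forall y, C y -> 0 < f i y -> 0 < f i w.
  have [[w [Cw fw]]|no] := pselect (exists w, C w /\ 0 < f i w).
    by exists w.
  by exists z; split => // y Cy fy; case: no; exists y.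
(* The extra index carries [z], so the average has a term even when [I] is empty. *)
pose N := #|I|.+1.
pose u (k : 'I_N) := if unlift ord0 k is Some i then w (enum_val i) else z.
have Cu k : C (u k) by rewrite /u; case: unlift => [i|//]; have [] := wP (enum_val i).
have N0 : 0 < N%:R^-1 :> R by rewrite invr_gt0 ltr0n.
pose x := \sum_(k < N) N%:R^-1 *: u k.
have Cx : C x.
  apply: conv_combination => //.
  by rewrite sumr_const card_ord -(mulr_natl N%:R^-1) mulfV// pnatr_eq0.
have posx i y : C y -> 0 < f i y -> 0 < f i x.
  (* The term of [w i] is positive and all others are nonnegative. *)
  move=> Cy fy; rewrite /x linear_sum (bigD1 (lift ord0 (enum_rank i)))//=.
  apply: ltr_wpDr.
    by apply: sumr_ge0 => k _; rewrite linearZ/= mulr_ge0 ?(ltW N0)//; have [_] := Cu k.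
  rewrite linearZ/= mulr_gt0// /u liftK enum_rankK.
  by have [_ /(_ y Cy fy)] := wP i.
exists x; first exact: relint_strict.
move=> y Cy; apply: relint_strict; first exact: midpoint_combination.
move=> i v Cv fv; rewrite linearZ linearD/= mulr_gt0 ?invr_gt0// ltr_pwDl ?(posx i v)//.
by have [_] := Cy.
Qed.

End Relint.

(** * The KKT polytope as such a set *)

Section Multipliers.
Variables (R : realType) (n : nat).
Implicit Types (P : 'M[R]_(n, 2)) (q : multiplier R n).

(** One finite index for all five blocks of multipliers, so that nonnegativity becomes a single
    finite family of linear constraints. *)
Definition coord_index : finType := (triple n + 'I_n + 'I_n + 'I_n + 'I_n)%type.

(* The name mup alone would denote the multiplicity of a polynomial root. *)
Definition mcoord (c : coord_index) (q : multiplier R n) : R :=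
  match c with
  | inl (inl (inl (inl t))) => mlam q t
  | inl (inl (inl (inr i))) => mleft q i
  | inl (inl (inr i)) => mright q i
  | inl (inr i) => mdown q i
  | inr i => Defs.mup q i
  end.

Lemma mcoord_is_scalar c : scalar (mcoord c).
Proof.
have fstl (U V : normedModType R) (g : multiplier R n -> U * V) :
  linear g -> linear (fun q => (g q).1) by move=> gl a x y; rewrite gl.
have sndl (U V : normedModType R) (g : multiplier R n -> U * V) :
  linear g -> linear (fun q => (g q).2) by move=> gl a x y; rewrite gl.
have entryl m j (g : multiplier R n -> 'rV[R]_m) :
  linear g -> scalar (fun q => g q 0 j) by move=> gl a x y; rewrite gl !mxE.
have idl : linear (fun q : multiplier R n => q) by [].
case: c => [[[[t|i]|i]|i]|i]; apply: entryl.
- exact: fstl _ _ _ (fstl _ _ _ (fstl _ _ _ (fstl _ _ _ idl))).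
- exact: sndl _ _ _ (fstl _ _ _ (fstl _ _ _ (fstl _ _ _ idl))).
- exact: sndl _ _ _ (fstl _ _ _ (fstl _ _ _ idl)).
- exact: sndl _ _ _ (fstl _ _ _ idl).
- exact: sndl _ _ _ idl.
Qed.

HB.instance Definition _ c :=
  GRing.isLinear.Build R (multiplier R n) R _ (mcoord c) (mcoord_is_scalar c).

Lemma mcoord_continuous c : continuous (mcoord c).
Proof.
have fstc (U V : normedModType R) (g : multiplier R n -> U * V) :
  continuous g -> continuous (fun q => (g q).1).
  by move=> gc q; apply: cvg_comp (gc q) _; exact: cvg_fst.
have sndc (U V : normedModType R) (g : multiplier R n -> U * V) :
  continuous g -> continuous (fun q => (g q).2).
  by move=> gc q; apply: cvg_comp (gc q) _; exact: cvg_snd.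
have entryc m j (g : multiplier R n -> 'rV[R]_m) :
  continuous g -> continuous (fun q => g q 0 j).
  by move=> gc q; exact: continuous_comp (gc q) (@coord_continuous R _ _ 0 j (g q)).
have idc : continuous (fun q : multiplier R n => q) by move=> q; exact: cvg_id.
case: c => [[[[t|i]|i]|i]|i]; apply: entryc.
- exact: fstc _ _ _ (fstc _ _ _ (fstc _ _ _ (fstc _ _ _ idc))).
- exact: sndc _ _ _ (fstc _ _ _ (fstc _ _ _ (fstc _ _ _ idc))).
- exact: sndc _ _ _ (fstc _ _ _ (fstc _ _ _ idc)).
- exact: sndc _ _ _ (fstc _ _ _ idc).
- exact: sndc _ _ _ idc.
Qed.

Lemma mcoord_sum c m (a : 'I_m -> R) (y : 'I_m -> multiplier R n) :
  mcoord c (\sum_k a k *: y k) = \sum_k a k * mcoord c (y k).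
Proof. by rewrite linear_sum; apply: eq_bigr => k _; rewrite linearZ. Qed.

(** The KKT conditions without the signs. With [P] fixed, complementarity only forces certain
    coordinates to vanish, so all that remains are affine equations in [q]. *)
Definition mult_affine P : set (multiplier R n) :=
  [set q | [/\ mult_complementary P q, \sum_t mlam q t = 1 & mult_stationary P q]].

(** Complementarity and stationarity are homogeneous linear in [q]; only the normalisation uses that
    the weights sum to 1. *)
Lemma mult_affineP P : affine_hull (mult_affine P) `<=` mult_affine P.
Proof.
move=> _ [m [a [y [Ay a1 ->]]]].
have lamE t : mlam (\sum_k a k *: y k) t = \sum_k a k * mlam (y k) t :=
  mcoord_sum (inl (inl (inl (inl t)))) m a y.
have leftE i : mleft (\sum_k a k *: y k) i = \sum_k a k * mleft (y k) i :=
  mcoord_sum (inl (inl (inl (inr i)))) m a y.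
have rightE i : mright (\sum_k a k *: y k) i = \sum_k a k * mright (y k) i :=
  mcoord_sum (inl (inl (inr i))) m a y.
have downE i : mdown (\sum_k a k *: y k) i = \sum_k a k * mdown (y k) i :=
  mcoord_sum (inl (inr i)) m a y.
have upE i : Defs.mup (\sum_k a k *: y k) i = \sum_k a k * Defs.mup (y k) i :=
  mcoord_sum (inr i) m a y.
split.
- split=> [t ht|i].
    rewrite lamE big1// => k _.
    by have [[/(_ t ht) -> _] _ _] := Ay k; rewrite mulr0.
  split=> hi; rewrite (leftE, rightE, downE, upE) big1// => k _;
    have [[_ /(_ i)[hl hr hd hu]] _ _] := Ay k;
    by rewrite (hl, hr, hd, hu) ?mulr0.
- under eq_bigr do rewrite lamE.
  rewrite exchange_big -[RHS]a1; apply: eq_bigr => k _.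
  by rewrite -mulr_sumr; have [_ -> _] := Ay k; rewrite mulr1.
- move=> i; rewrite leftE rightE downE upE.
  (* The residual of the combination is the combination of the residuals, each of which is zero. *)
  transitivity (\sum_k a k *: (\sum_t mlam (y k) t *: grad_area P t i
      + vec2 (mleft (y k) i - mright (y k) i)
             (mdown (y k) i - Defs.mup (y k) i))); last first.
    by rewrite big1// => k _; have [_ _ ->] := Ay k; rewrite scaler0.
  under [RHS]eq_bigr do rewrite scalerDr scaler_sumr.
  rewrite big_split/= exchange_big/=; congr (_ + _).
    apply: eq_bigr => t _; rewrite lamE scaler_suml.
    by apply: eq_bigr => k _; rewrite scalerA.
  apply/rowP => c; rewrite summxE /vec2 mxE.
  under [RHS]eq_bigr do rewrite !mxE.
  by case: c => -[|[|]]//= _; rewrite -sumrB; apply: eq_bigr => k _; rewrite mulrBr.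
Qed.

Lemma KKTE P : KKT P = [set q | mult_affine P q /\ forall c, 0 <= mcoord c q].
Proof.
apply/seteqP; split=> q /=.
  move=> [[l0 b0] ? ? ?]; split => // -[[[[t|i]|i]|i]|i]//=;
  by have [] := b0 i.
move=> [[? ? ?] c0]; split => //; split => [t|i].
  exact: (c0 (inl (inl (inl (inl t))))).
split.
- exact: (c0 (inl (inl (inl (inr i))))).
- exact: (c0 (inl (inl (inr i)))).
- exact: (c0 (inl (inr i))).
- exact: (c0 (inr i)).
Qed.

Lemma Bq_midpoint P q r : Bq P (2^-1 *: (q + r)) = 2^-1 *: (Bq P q + Bq P r).
Proof.
have midE c : mcoord c (2^-1 *: (q + r)) = 2^-1 * (mcoord c q + mcoord c r).
  by rewrite linearZ linearD.
rewrite /Bq -big_split/= scaler_sumr; apply: eq_bigr => t _.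
by rewrite -scalerDl [RHS]scalerA; congr (_ *: _); exact: (midE (inl (inl (inl (inl t))))).
Qed.

Lemma relint_separates P q (v : 'cV[R]_n) : KKT P q -> Bq P q *m v != 0 ->
  exists2 r, relint (KKT P) r & Bq P r *m v != 0.
Proof.
move=> Kq Bqv.
have [|x xK midK] := relint_midpoint R _ coord_index mcoord (mult_affine P)
    mcoord_continuous (mult_affineP P); first by exists q; rewrite -KKTE.
rewrite -KKTE in xK midK.
have [Bxv|] := eqVneq (Bq P x *m v) 0; last by exists x.
(* [Bq P x] kills [v], so at the midpoint the value is half of [Bq P q *m v], which is nonzero. *)
exists (2^-1 *: (x + q)); first exact: midK.
by rewrite Bq_midpoint -scalemxAl mulmxDl Bxv add0r scaler_eq0 invr_eq0 pnatr_eq0.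
Qed.

End Multipliers.

Theorem theorem5p2 (R : realType) (n : nat) (P : 'M[R]_(n, 2)) :
  (3 <= n)%N -> positive_area_local_optimum P ->
  exists (s : nat) (q : 'I_s -> multiplier R n),
    [/\ (s <= n - \dim (shared_kernel P))%N,
        (forall alpha, relint (KKT P) (q alpha))
      & shared_kernel P = (\bigcap_(alpha < s) kerB P (q alpha))%VS].
Proof.
move=> _ _.
have kerBN q v : v \notin kerB P q <-> Bq P q *m v != 0.
  by rewrite /kerB memv_ker lfunE.
(* The intersection runs over all of [KKT P], while the greedy choice draws only from
   [relint (KKT P)]. *)
have [| q v Kq /kerBN Bqv | s [q [les Kq capE]]] :=
    vcap_greedy _ _ _ (KKT P) (relint (KKT P)) (kerB P).
- by move=> q [].
- have [r rK /kerBN Br] := relint_separates R n P q v Kq Bqv.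
  by exists r.
- exists s, q; split => //.
  by move: les; rewrite dim_matrix [(n * 1)%R]muln1.
Qed.
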